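(* Consider the CPE-B problem in the fixed-budget setting with $n$ base arms, $R$-sub-Gaussian rewards and decision class $\mathcal{M}$. For any budget $T>n$, algorithm BSAR uses at most $T$ samples and returns the optimal super arm $M_*$ with the error probability bounded by $$O\left(n^2\exp\left(-\frac{T-n}{\widetilde{\log}(n)\,R^2H^{B}}\right)\right).$$
   Context: CPE-B (combinatorial pure exploration with bottleneck reward). There are $n$ base arms $[n]=\{1,\dots,n\}$. Each base arm $e$ has an unknown reward distribution with mean $w(e)$ and an $R$-sub-Gaussian tail ($R>0$): if $X$ is a random reward of $e$, then $\mathbb{E}[\exp(\lambda(X-w(e)))]\le\exp(\lambda^2R^2/2)$ for all $\lambda\in\mathbb{R}$. Write $\boldsymbol{w}=(w(1),\dots,w(n))$. A decision class $\mathcal{M}\subseteq 2^{[n]}$ of super arms (nonempty subsets of $[n]$) is given. For $M\in\mathcal{M}$ and a vector $\boldsymbol{v}$ with entries in $\mathbb{R}\cup\{\infty\}$ let $\mathrm{MinW}(M,\boldsymbol{v})=\min_{e\in M}v(e)$. The optimal super arm $M_*=\operatorname{argmax}_{M\in\mathcal{M}}\mathrm{MinW}(M,\boldsymbol{w})$ is assumed unique, and $\mathrm{OPT}=\mathrm{MinW}(M_*,\boldsymbol{w})$. At each timestep the learner plays one base arm and observes an independent sample of its reward. In the fixed-budget setting the learner may use at most $T$ samples; the error probability is the probability that the returned set is not $M_*$. Hardness. $\Delta^{B}_e=\mathrm{OPT}-\max_{M\in\mathcal{M}:e\notin M}\mathrm{MinW}(M,\boldsymbol{w})$ if $e\in M_*$,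 and $\Delta^{B}_e=\mathrm{OPT}-\max_{M\in\mathcal{M}:e\in M}\mathrm{MinW}(M,\boldsymbol{w})$ if $e\notin M_*$ (maximum over the empty set is $-\infty$, $1/\infty^2=0$). Let $\Delta^{B}_{(1)}\le\dots\le\Delta^{B}_{(n)}$ be the sorted values of $\Delta^B_1,\dots,\Delta^B_n$, $H^{B}=\max_{i\in[n]}i/(\Delta^{B}_{(i)})^2$, and $\widetilde{\log}(n)=\sum_{i=1}^n1/i$. Algorithm BSAR. For $e\in[n]\cup\{\perp\}$ and $R'\subseteq[n]$, $\mathrm{AR\text{-}Oracle}(e,R',\boldsymbol{v})$ returns a super arm maximizing $\mathrm{MinW}(M,\boldsymbol{v})$ over $M\in\mathcal{M}$ with $e\in M$ (no such requirement if $e=\perp$) and $M\cap R'=\varnothing$; it returns $\perp$ if there is none, and $\mathrm{MinW}(\perp,\cdot)=-\infty$. Set $\tilde T_0=0$, $A_1=R_1=\varnothing$. For $t=1,\dots,n$: let $\tilde T_t=\lceil (T-n)/(\widetilde{\log}(n)(n-t+1))\rceil$ and $U_t=[n]\setminus(A_t\cup R_t)$; play each $e\in U_t$ for $\tilde T_t-\tilde T_{t-1}$ times and let $\hat w_t(e)$ be the empirical mean of all its samples so far; set $\hat w_t(e)=\infty$ for $e\in A_t$. Let $M_t=\mathrm{AR\text{-}Oracle}(\perp,R_t,\hat{\boldsymbol{w}}_t)$. For each $e\in U_t$ let $\tilde M_{t,e}=\mathrm{AR\text{-}Oracle}(\perp,R_t\cup\{e\},\hat{\boldsymbol{w}}_t)$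 if $e\in M_t$ and $\tilde M_{t,e}=\mathrm{AR\text{-}Oracle}(e,R_t,\hat{\boldsymbol{w}}_t)$ otherwise. Let $p_t\in\operatorname{argmax}_{e\in U_t}\big(\mathrm{MinW}(M_t,\hat{\boldsymbol{w}}_t)-\mathrm{MinW}(\tilde M_{t,e},\hat{\boldsymbol{w}}_t)\big)$. If $p_t\in M_t$, set $A_{t+1}=A_t\cup\{p_t\}$, $R_{t+1}=R_t$; otherwise $A_{t+1}=A_t$, $R_{t+1}=R_t\cup\{p_t\}$. Return $A_{n+1}$.
   Formalization: The bound is proved as C n² exp(−c (T−n)/(log~(n) R² H^B)) with absolute constants C, c > 0; with c = 1 in the exponent, as literally written, it fails already for two Gaussian arms and the class {{1},{2}}. *)

(* Defs.v *)
From mathcomp Require Export all_boot all_order all_algebra.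
From mathcomp Require Export all_classical all_reals all_analysis.
Set Implicit Arguments.
Unset Strict Implicit.
Unset Printing Implicit Defensive.
Import Order.TTheory GRing.Theory Num.Theory.
Local Open Scope ring_scope.
Local Open Scope classical_set_scope.

Definition has_mean (R : realType) (nu : probability R R) (m : R) : Prop :=
  nu.-integrable [set: R] EFin /\ (\int[nu]_x x%:E = m%:E)%E.

Definition sub_gaussian (R : realType) (nu : probability R R) (m r : R) : Prop :=
  forall lam : R,
    (\int[nu]_x (expR (lam * (x - m)))%:E
       <= (expR (lam ^+ 2 * r ^+ 2 / 2))%:E)%E.

Definition mutually_independent (d : measure_display) (Omega : measurableType d)
    (R : realType) (P : probability Omega R) (I : eqType)
    (X : I -> Omega -> R) : Prop :=
  forall (s : seq I) (B : I -> set R), uniq s ->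
    (forall i, measurable (B i)) ->
    (P (\bigcap_(i in [set` s]) (X i @^-1` B i))
       = \prod_(i <- s) P (X i @^-1` B i))%E.

(* [X e s] is the reward observed at the [s]-th play (counting from 0) of the
   base arm [e]: a fresh sample, independent of everything else, from the
   reward distribution [nu e]. *)
Definition reward_samples (d : measure_display) (Omega : measurableType d)
    (R : realType) (P : probability Omega R) (n : nat)
    (nu : 'I_n -> probability R R) (X : 'I_n -> nat -> {RV P >-> R}) : Prop :=
  (forall e s (B : set R), measurable B -> P (X e s @^-1` B) = nu e B) /\
  mutually_independent P (fun i : 'I_n * nat => X i.1 i.2 : Omega -> R).

Definition decision_class (n : nat) (MM : {set {set 'I_n}}) : Prop :=
  finset.set0 \notin MM.

(* The default value [+oo] is only reached at the empty set, which is not a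
   super arm. *)
Definition MinW (R : realType) (n : nat) (M : {set 'I_n}) (v : 'I_n -> \bar R)
    : \bar R :=
  \big[Order.min/+oo%E]_(e in M) v e.

(* [None] stands for the answer "no feasible super arm" of the oracle. *)
Definition MinW_opt (R : realType) (n : nat) (o : option {set 'I_n})
    (v : 'I_n -> \bar R) : \bar R :=
  if o is Some M then MinW M v else -oo%E.

Definition mean_vector (R : realType) (n : nat) (w : 'I_n -> R)
    : 'I_n -> \bar R := fun e => (w e)%:E.

Definition unique_optimum (R : realType) (n : nat) (MM : {set {set 'I_n}})
    (w : 'I_n -> R) (Mstar : {set 'I_n}) : Prop :=
  Mstar \in MM /\
  forall M, M \in MM -> M != Mstar ->
    (MinW M (mean_vector w) < MinW Mstar (mean_vector w))%E.

(* A maximum over the empty family is [-oo], so that a gap may be [+oo]. *)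
Definition gapB (R : realType) (n : nat) (MM : {set {set 'I_n}})
    (w : 'I_n -> R) (Mstar : {set 'I_n}) (e : 'I_n) : \bar R :=
  let OPT := MinW Mstar (mean_vector w) in
  if e \in Mstar then
    (OPT - \big[Order.max/-oo]_(M in MM | e \notin M) MinW M (mean_vector w))%E
  else
    (OPT - \big[Order.max/-oo]_(M in MM | e \in M) MinW M (mean_vector w))%E.

Definition sorted_gapsB (R : realType) (n : nat) (MM : {set {set 'I_n}})
    (w : 'I_n -> R) (Mstar : {set 'I_n}) : seq (\bar R) :=
  sort <=%O [seq gapB MM w Mstar e | e <- enum 'I_n].

(* The [i]-th smallest gap, 1-based, is the entry [i.-1] of [sorted_gapsB].
   In [\bar R] the inverse of [+oo] is 0. *)
Definition HB (R : realType) (n : nat) (MM : {set {set 'I_n}})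
    (w : 'I_n -> R) (Mstar : {set 'I_n}) : \bar R :=
  (\big[Order.max/-oo]_(1 <= i < n.+1)
     (i%:R%:E / (nth 0 (sorted_gapsB MM w Mstar) i.-1) ^+ 2))%E.

Definition logtilde (R : realType) (n : nat) : R :=
  \sum_(1 <= i < n.+1) i%:R^-1.

(* The exponent x in the error bound O(n^2 exp(- x)). This bound is to be read
   as C n^2 exp(- c x) with absolute constants C, c > 0: with c = 1 it already
   fails for two Gaussian arms and the decision class {{1}, {2}}.
   When [H] is 0 (all gaps infinite) x is [+oo], the inverse of 0 in [\bar R]
   being [+oo]. *)
Definition exponentB (R : realType) (n T : nat) (r : R) (H : \bar R) : \bar R :=
  ((T%:R - n%:R)%:E / ((logtilde R n * r ^+ 2)%:E * H))%E.

Definition AR_feasible (n : nat) (MM : {set {set 'I_n}}) (e : option 'I_n)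
    (R' M : {set 'I_n}) : bool :=
  [&& M \in MM, (if e is Some e0 then e0 \in M else true)
    & [disjoint M & R']].

Definition oracle_type (R : realType) (n : nat) : Type :=
  option 'I_n -> {set 'I_n} -> ('I_n -> \bar R) -> option {set 'I_n}.

Definition AR_oracle (R : realType) (n : nat) (MM : {set {set 'I_n}})
    (oracle : oracle_type R n) : Prop :=
  forall e R' v,
    match oracle e R' v with
    | Some M => AR_feasible MM e R' M /\
        forall M', AR_feasible MM e R' M' -> (MinW M' v <= MinW M v)%E
    | None => forall M', ~~ AR_feasible MM e R' M'
    end.

(* [sel t U g] is the element of U chosen at round t among the maximizers of g:
   ties may be broken arbitrarily. *)
Definition select_type (R : realType) (n : nat) : Type :=
  nat -> {set 'I_n} -> ('I_n -> \bar R) -> 'I_n.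

Definition argmax_select (R : realType) (n : nat) (sel : select_type R n)
    : Prop :=
  forall t (U : {set 'I_n}) g, (0 < #|U|)%N ->
    sel t U g \in U /\ forall e, e \in U -> (g e <= g (sel t U g))%E.

Definition Ttilde (R : realType) (n T t : nat) : nat :=
  if t is 0 then 0%N
  else absz (Num.ceil ((T%:R - n%:R) / (logtilde R n * (n - t + 1)%:R) : R)).

(* [plays e] is the number of samples of [e] observed so far. *)
Record bsar_state (n : nat) := BsarState {
  accepted : {set 'I_n};
  rejected : {set 'I_n};
  plays : 'I_n -> nat }.

Definition bsar_init (n : nat) : bsar_state n :=
  BsarState finset.set0 finset.set0 (fun=> 0%N).

Definition emp_mean (R : realType) (x : nat -> R) (k : nat) : R :=
  (\sum_(i < k) x i) / k%:R.

(* Round [t] (for 1 <= t <= n) on the reward table [x]. The value of [what] at a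
   rejected arm is irrelevant: the oracle is never asked for sets meeting [Rj]. *)
Definition bsar_step (R : realType) (n T : nat) (oracle : oracle_type R n)
    (sel : select_type R n) (x : 'I_n -> nat -> R) (t : nat)
    (st : bsar_state n) : bsar_state n :=
  let A := accepted st in
  let Rj := rejected st in
  let U := ~: (A :|: Rj) in
  let N := fun e => if e \in U
    then (plays st e + (Ttilde R n T t - Ttilde R n T t.-1))%N
    else plays st e in
  let what : 'I_n -> \bar R := fun e =>
    if e \in A then +oo%E else (emp_mean (x e) (N e))%:E in
  let Mt := oracle None Rj what in
  let in_Mt := fun e => if Mt is Some M then e \in M else false in
  let Mtilde := fun e =>
    if in_Mt e then oracle None (e |: Rj) what else oracle (Some e) Rj what in
  let p := sel t U (fun e => MinW_opt Mt what - MinW_opt (Mtilde e) what)%E in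
  if in_Mt p then BsarState (p |: A) Rj N else BsarState A (p |: Rj) N.

Fixpoint bsar_after (R : realType) (n T : nat) (oracle : oracle_type R n)
    (sel : select_type R n) (x : 'I_n -> nat -> R) (t : nat) : bsar_state n :=
  if t is t'.+1
  then bsar_step T oracle sel x t (bsar_after T oracle sel x t')
  else bsar_init n.

Definition bsar_output (R : realType) (n T : nat) (oracle : oracle_type R n)
    (sel : select_type R n) (x : 'I_n -> nat -> R) : {set 'I_n} :=
  accepted (bsar_after T oracle sel x n).

Definition bsar_samples (R : realType) (n T : nat) (oracle : oracle_type R n)
    (sel : select_type R n) (x : 'I_n -> nat -> R) : nat :=
  (\sum_e plays (bsar_after T oracle sel x n) e)%N.

(* Main.v *)
(** Count rounds from 0, let D_t be the (n-t)-th smallest gap, and call the run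
good if at every round t where D_t is finite all empirical means are within
D_t / 2 of the true means. On a good run every decision is correct. Indeed, n-t
arms are undecided, so one of them, e, has gap at least D_t; then any super arm
still available which disagrees with M_* about e has an empirical value strictly
below that of M_* (infinite on accepted arms), since its bottleneck is an arm
outside M_*, hence undecided. So M_t agrees with M_* about e, and the runner-up
for e has value below M_*. If M_t disagreed with M_* about the selected arm p,
then M_* would compete in the runner-up for p, whose value would exceed the one
for e, against the maximality of the empirical gap of p.
A run is bad with probability at most the sum over the n^2 pairs (round, arm) of
a Chernoff bound, each at most twice exp(-(T-n) / (8 log~(n) R^2 H)). *)

Require Import Defs.
From HB Require Import structures.
From mathcomp Require Import all_boot all_order all_algebra.
From mathcomp Require Import all_classical all_reals all_analysis.
From mathcomp Require Import measurable_realfun.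
From mathcomp Require Import ring lra zify.
Set Implicit Arguments.
Unset Strict Implicit.
Unset Printing Implicit Defensive.
Import Order.TTheory GRing.Theory Num.Theory.
Local Open Scope ring_scope.
Local Open Scope classical_set_scope.

Import HBNNSimple.

(** * Independence and sub-Gaussian tails *)

(** Both sides are additive in [f] and commute with monotone limits, so the factorization passes
    from indicators to simple functions and then to nonnegative measurable [f]. *)
Lemma ge0_integral_factor d (T : measurableType d) (R : realType)
    (mu : {measure set T -> \bar R}) (h : T -> R) (Y : T -> R)
    (a : \bar R) (f : R -> R) :
  (measurable_fun [set: T] h -> (forall x, 0 <= h x)%R ->
  measurable_fun [set: T] Y -> 0 <= a -> a \is a fin_num ->
  (forall B, measurable B ->
    \int[mu]_x (h x * \1_B (Y x))%:E = a * \int[mu]_x (\1_B (Y x))%:E) ->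
  measurable_fun [set: R] f -> (forall y, 0 <= f y)%R ->
  \int[mu]_x (h x * f (Y x))%:E = a * \int[mu]_x (f (Y x))%:E)%E.
Proof.
move=> mh h0 mY a0 afin hB mf f0.
have mE (u : T -> R) : measurable_fun [set: T] u ->
    measurable_fun [set: T] (fun x => (u x)%:E).
  by move=> mu_; exact/measurable_EFinP.
have mB k (g : {nnsfun R >-> R}) :
    measurable_fun [set: T] (fun x => \1_(g @^-1` [set k]) (Y x) : R).
  exact: measurableT_comp.
have mg (g : {nnsfun R >-> R}) : measurable_fun [set: T] (fun x => g (Y x)).
  exact: measurableT_comp.
have hS (g : {nnsfun R >-> R}) :
    (\int[mu]_x (h x * g (Y x))%:E = a * \int[mu]_x (g (Y x))%:E)%E.
  pose K := finmap.enum_fset (fset_set (range g)).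
  (* Truncating [k] at 0 makes every summand nonnegative, as additivity of the integral requires; it
     changes nothing, since a negative [k] has empty preimage. *)
  pose F k x := Num.max k 0 * \1_(g @^-1` [set k]) x.
  have F0 k x : 0 <= F k x by rewrite mulr_ge0// le_max lexx orbT.
  have gE x : g x = \sum_(k <- K) F k x.
    rewrite fimfunE fsbig_finite//=; apply: eq_bigr => k _; rewrite /F.
    case: ltP => // k0; first by rewrite preimage_nnfun0// indic0 !mulr0.
  have mF k : measurable_fun [set: T] (fun x => F k (Y x)).
    exact: measurable_funM.
  under eq_integral do rewrite gE mulr_sumr -sumEFin.
  under [in RHS]eq_integral do rewrite gE -sumEFin.
  rewrite !ge0_integral_sum//; last 4 first.
  - by move=> k; exact: mE.
  - by move=> k x _; rewrite lee_fin.
  - by move=> k; apply: mE; exact: measurable_funM.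
  - by move=> k x _; rewrite lee_fin mulr_ge0.
  rewrite ge0_sume_distrr; last first.
    by move=> k _; apply: integral_ge0 => x _; rewrite lee_fin.
  apply: eq_bigr => k _; rewrite /F.
  under eq_integral do rewrite mulrCA EFinM.
  under [in RHS]eq_integral do rewrite EFinM.
  rewrite !ge0_integralZl_EFin//; last 5 first.
  - exact: mE.
  - by rewrite le_max lexx orbT.
  - by move=> x _; rewrite lee_fin mulr_ge0.
  - by apply: mE; exact: measurable_funM.
  - by rewrite le_max lexx orbT.
  by rewrite hB// muleCA.
have mEf : measurable_fun [set: R] (EFin \o f) by exact/measurable_EFinP.
pose g := nnsfun_approx measurableT mEf.
have gf y : (g n y)%:E @[n --> \oo] --> (f y)%:E.
  by apply: (cvg_nnsfun_approx measurableT mEf) => // z _; rewrite lee_fin.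
have nd_g y : {homo (fun n => g n y) : m n / (m <= n)%N >-> m <= n}.
  by move=> m n mn; exact/lefP/nd_nnsfun_approx.
have L : (\int[mu]_x (h x * g n (Y x))%:E @[n --> \oo] -->
    \int[mu]_x (h x * f (Y x))%:E)%E.
  rewrite (_ : (\int[mu]_x (h x * f (Y x))%:E =
      \int[mu]_x (limn (fun n => (h x * g n (Y x))%:E)))%E); last first.
    apply: eq_integral => x _; apply/esym/cvg_lim => //.
    under eq_fun do rewrite EFinM.
    by rewrite EFinM; exact: cvgeZl.
  apply: cvg_monotone_convergence => //.
  - by move=> n; apply: mE; apply: measurable_funM.
  - by move=> n x _; rewrite lee_fin mulr_ge0.
  - by move=> x _ m n mn; rewrite lee_fin ler_wpM2l// nd_g.
have Rr : (\int[mu]_x (g n (Y x))%:E @[n --> \oo] -->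
    \int[mu]_x (f (Y x))%:E)%E.
  rewrite (_ : (\int[mu]_x (f (Y x))%:E =
      \int[mu]_x (limn (fun n => (g n (Y x))%:E)))%E); last first.
    by apply: eq_integral => x _; apply/esym/cvg_lim => //; exact: gf.
  apply: cvg_monotone_convergence => //.
  - by move=> n; exact: mE.
  - by move=> n x _; rewrite lee_fin.
  - by move=> x _ m n mn; rewrite lee_fin nd_g.
apply: (cvg_unique _ L) => //.
rewrite (_ : (fun n => _) = (fun n => a * \int[mu]_x (g n (Y x))%:E)%E).
  exact: cvgeZl.
by apply/funext => n; exact: hS.
Qed.

Lemma integral_prod_independent d (Omega : measurableType d) (R : realType)
    (P : probability Omega R) (I : eqType) (X : I -> Omega -> R)
    (s : seq I) (f : I -> R -> R) :
  mutually_independent P X -> (forall i, measurable_fun [set: Omega] (X i)) ->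
  uniq s -> (forall i, measurable_fun [set: R] (f i)) ->
  (forall i y, 0 <= f i y) ->
  (forall i, (\int[P]_x (f i (X i x))%:E \is a fin_num)%E) ->
  (\int[P]_x (\prod_(i <- s) f i (X i x))%:E =
     \prod_(i <- s) \int[P]_x (f i (X i x))%:E)%E.
Proof.
move=> indX mX.
have mXB (B : set R) i : measurable B -> measurable (X i @^-1` B).
  by move=> mB; rewrite -[_ @^-1` _]setTI; exact: mX.
(* Indicators are replaced by general functions one index at a time: at the
   indices of [s2] the function is still the indicator of [B]. *)
suff {s f} H s2 s (B : I -> set R) (f : I -> R -> R) :
    (forall i, measurable (B i)) -> (forall i, i \in s2 -> f i = \1_(B i)) ->
    uniq (s ++ s2) -> (forall i, measurable_fun [set: R] (f i)) ->
    (forall i y, 0 <= f i y) ->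
    (forall i, (\int[P]_x (f i (X i x))%:E \is a fin_num)%E) ->
    (\int[P]_x (\prod_(i <- s ++ s2) f i (X i x))%:E =
       \prod_(i <- s ++ s2) \int[P]_x (f i (X i x))%:E)%E.
  by have := H [::] s (fun=> setT) f; rewrite cats0; apply.
elim: s s2 B f => [|i s IH] s2 B f mB fB us mf f0 ffin.
  rewrite /=.
  (* With indicators only, the product is the indicator of an intersection, and the claim is the
     definition of independence. *)
  have -> : (\int[P]_x (\prod_(i <- s2) f i (X i x))%:E =
      \int[P]_x (\1_(\bigcap_(i in [set` s2]) (X i @^-1` B i)) x)%:E)%E.
    apply: eq_integral => x _; congr EFin.
    rewrite big_seq (eq_bigr (fun i => \1_(B i) (X i x))); last first.
      by move=> i /fB ->.
    have [/= h|/= h] := pselect (forall i, i \in s2 -> B i (X i x)).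
      rewrite big1 ?indicE ?mem_set// => i is2.
      by rewrite indicE mem_set//; exact: h.
    move/existsNP : h => [i /not_implyP[is2 nB]].
    rewrite indicE memNset; last by move=> /(_ i is2).
    apply/eqP; rewrite -big_seq prodf_seq_eq0; apply/hasP; exists i => //=.
    by rewrite indicE memNset.
  rewrite integral_indic//; last first.
    apply: fin_bigcap_measurable => [|i _]; first exact: finite_seq.
    exact: mXB.
  rewrite setIT; apply: etrans (indX _ _ us mB) _.
  apply: eq_big_seq => i is2; rewrite fB//=.
  rewrite (_ : (fun x => _) = EFin \o \1_(X i @^-1` B i))//.
  by rewrite integral_indic ?setIT//; exact: mXB.
have cons_perm : perm_eq (s ++ i :: s2) (i :: s ++ s2).
  by rewrite -cat1s perm_catCA.
have ucons : uniq (s ++ i :: s2) by rewrite (perm_uniq cons_perm).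
have notin j : j \in s ++ s2 -> j == i = false.
  move=> js; apply/eqP => ji; move: us; rewrite /= -ji; move: js.
  by rewrite mem_cat => ->.
rewrite cat_cons big_cons muleC.
under eq_integral do rewrite big_cons mulrC.
(* Here [h] is the product over the other indices. It remains to treat an indicator [\1_B'] at index
   [i], which is the induction hypothesis with [i] moved into the indicator list. *)
apply: ge0_integral_factor => //.
- by apply: measurable_prod => j _; apply: measurableT_comp.
- by move=> x; apply: prodr_ge0.
- by apply: prode_ge0 => j _; apply: integral_ge0 => x _; rewrite lee_fin.
- by apply: prode_fin_num.
move=> B' mB'.
have := IH (i :: s2) (fun j => if j == i then B' else B j)
  (fun j => if j == i then \1_B' else f j).
rewrite (perm_big _ cons_perm)/= big_cons eqxx muleC.
rewrite big_seq (eq_bigr (fun j => \int[P]_x (f j (X j x))%:E)%E); last first.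
  by move=> j /notin ->.
rewrite -big_seq => <- //.
- apply: eq_integral => x _; congr EFin.
  rewrite (perm_big _ cons_perm)/= big_cons eqxx mulrC; congr (_ * _).
  by rewrite big_seq [RHS]big_seq; apply: eq_bigr => j /notin ->.
- by move=> j; case: ifP.
- move=> j; rewrite inE; case: eqP => //= _; exact: fB.
- by move=> j; case: ifP.
- by move=> j y; case: ifP.
- move=> j; case: eqP => [->|//].
  rewrite (_ : (fun x => _) = EFin \o \1_(X i @^-1` B'))//.
  rewrite integral_indic ?setIT//; last exact: mXB.
  by rewrite fin_num_measure//; exact: mXB.
Qed.

Lemma subgaussian_tail d (Omega : measurableType d) (R : realType)
    (P : probability Omega R) (S : Omega -> R) (V a : R) :
  measurable_fun [set: Omega] S -> 0 < V -> 0 < a ->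
  (forall lam : R, (\int[P]_x (expR (lam * S x))%:E <=
    (expR (lam ^+ 2 * V / 2))%:E)%E) ->
  (P [set x | (a <= S x)%R] <= (expR (- (a ^+ 2 / (2 * V))))%:E)%E.
Proof.
move=> mS V0 a0 mgf.
pose S' : {RV P >-> R} := HB.pack S (isMeasurableFun.Build _ _ _ _ S mS).
(* The value [a / V] minimizes the Chernoff exponent [lam ^+ 2 * V / 2 - lam * a]. *)
have lam0 : 0 < a / V by rewrite divr_gt0.
apply: le_trans (chernoff S' a lam0) _.
rewrite /mmt_gen_fun unlock.
apply: (@le_trans _ _
    ((expR ((a / V) ^+ 2 * V / 2))%:E * (expR (- (a / V * a)))%:E)%E).
  apply: lee_wpmul2r; first by rewrite lee_fin expR_ge0.
  apply: le_trans (mgf (a / V)).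
  by under eq_integral do rewrite /= mulrC.
rewrite -EFinM -expRD lee_fin ler_expR le_eqVlt; apply/orP; left; apply/eqP.
by field; rewrite gt_eqF.
Qed.

(** By independence the centred sum of [k] samples is sub-Gaussian with variance proxy
    [k%:R * r ^+ 2]. The tail bound at level [k%:R * eps] is applied to the sum and to its opposite,
    whence the factor 2. *)
Lemma emp_mean_tail d (Omega : measurableType d) (R : realType)
    (P : probability Omega R) (X : nat -> Omega -> R) (m r eps : R) (k : nat) :
  (forall s, measurable_fun [set: Omega] (X s)) ->
  mutually_independent P X ->
  (forall s lam, (\int[P]_x (expR (lam * (X s x - m)))%:E <=
     (expR (lam ^+ 2 * r ^+ 2 / 2))%:E)%E) ->
  0 < r -> 0 < eps -> (0 < k)%N ->
  (P [set x | (eps <= `|emp_mean (X ^~ x) k - m|)%R] <=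
    (2 * expR (- (k%:R * eps ^+ 2 / (2 * r ^+ 2))))%:E)%E.
Proof.
move=> mX indX sgX r0 eps0 k0.
have kR : (0 : R) < k%:R by rewrite ltr0n.
pose D s x := X s x - m.
have mD s : measurable_fun [set: Omega] (D s) by apply: measurable_funB.
pose S x := \sum_(s < k) D s x.
have mS : measurable_fun [set: Omega] S.
  by apply: measurable_sum => i.
have SE x : emp_mean (X ^~ x) k - m = S x / k%:R.
  rewrite /emp_mean /S big_split/= sumr_const card_ord mulrDl.
  by rewrite -[- m *+ k]mulr_natr mulfK// gt_eqF.
have mgf (lam : R) : (\int[P]_x (expR (lam * S x))%:E <=
    (expR (lam ^+ 2 * (k%:R * r ^+ 2) / 2))%:E)%E.
  pose f (s : nat) y := expR (lam * (y - m)).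
  have mf s : measurable_fun [set: R] (f s).
    by apply: measurableT_comp => //; apply: measurable_funM => //;
       apply: measurable_funB.
  have -> : (\int[P]_x (expR (lam * S x))%:E =
      \int[P]_x (\prod_(s <- iota 0 k) f s (X s x))%:E)%E.
    apply: eq_integral => x _; congr EFin.
    by rewrite /S mulr_sumr expR_sum -[k in iota 0 k]subn0 -/(index_iota 0 k)
      big_mkord.
  have fin s : (\int[P]_x (f s (X s x))%:E \is a fin_num)%E.
    rewrite ge0_fin_numE; first by rewrite (le_lt_trans (sgX s lam))// ltry.
    by apply: integral_ge0 => x _; rewrite lee_fin expR_ge0.
  rewrite integral_prod_independent ?iota_uniq//; last first.
    by move=> s y; exact: expR_ge0.
  under eq_bigr do rewrite -(fineK (fin _)).
  rewrite prodEFin lee_fin.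
  rewrite (_ : _ / 2 = \sum_(s <- iota 0 k) lam ^+ 2 * r ^+ 2 / 2); last first.
    by rewrite big_const_seq count_predT size_iota iter_addr_0 -mulr_natr; ring.
  rewrite expR_sum; apply: ler_prod => s _; rewrite -!lee_fin fineK// sgX andbT.
  by apply: integral_ge0 => x _; rewrite lee_fin expR_ge0.
have mgfN (lam : R) : (\int[P]_x (expR (lam * - S x))%:E <=
    (expR (lam ^+ 2 * (k%:R * r ^+ 2) / 2))%:E)%E.
  rewrite -(sqrrN lam); under eq_integral do rewrite mulrN -mulNr.
  exact: mgf.
have V0 : 0 < k%:R * r ^+ 2 by rewrite mulr_gt0// exprn_gt0.
have a0 : 0 < k%:R * eps by rewrite mulr_gt0.
have mNS : measurable_fun [set: Omega] (fun x => - S x).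
  exact: measurableT_comp.
have -> : [set x | eps <= `|emp_mean (X ^~ x) k - m|] =
    [set x | k%:R * eps <= S x] `|` [set x | k%:R * eps <= - S x].
  apply/seteqP; split => x /=; rewrite SE normrM normfV (gtr0_norm kR).
  - rewrite ler_pdivlMr// mulrC lerNr ler_normr => /orP[]; first by left.
    by rewrite lerNr; right.
  - by rewrite ler_pdivlMr// mulrC ler_normr => -[->//|->]; rewrite orbT.
have mle (g : Omega -> R) b : measurable_fun [set: Omega] g ->
    measurable [set x | b <= g x].
  move=> mg; rewrite (_ : [set x | _] = g @^-1` `[b, +oo[%classic); last first.
    by apply/seteqP; split => x /=; rewrite in_itv/= andbT.
  by rewrite -[_ @^-1` _]setTI; exact: mg.
apply: (le_trans (measureU2 P (mle _ _ mS) (mle _ _ mNS))).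
rewrite mulr2n mulrDl mul1r EFinD.
have -> : k%:R * eps ^+ 2 / (2 * r ^+ 2) =
    (k%:R * eps) ^+ 2 / (2 * (k%:R * r ^+ 2)).
  by field; rewrite !gt_eqF.
by apply: leeD; apply: subgaussian_tail.
Qed.

(** * Correctness of a good run *)

Section bottleneck.
Variables (R : realType) (n : nat).
Implicit Types (M N Mstar A Rj : {set 'I_n}) (MM : {set {set 'I_n}}).
Implicit Types (v : 'I_n -> \bar R) (w m : 'I_n -> R).

Lemma disjoint_setU1r M N (e : 'I_n) :
  [disjoint M & (e |: N)%SET]%B = (e \notin M) && [disjoint M & N].
Proof.
rewrite !finset.disjoints_subset finset.setCU finset.subsetI.
by rewrite -finset.disjoints_subset disjoint_sym finset.disjoints1.
Qed.

Lemma MinW_le M v e : e \in M -> (MinW M v <= v e)%E.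
Proof. by move=> eM; exact: bigmin_le_cond. Qed.

Lemma MinW_attained M v :
  M != finset.set0 -> exists2 e, e \in M & MinW M v = v e.
Proof.
case/finset.set0Pn => e eM.
have [i iM Ei] := @eq_bigmin _ _ _ +oo%E e (fun i => i \in M) v eM
  (fun i _ => leey (v i)).
by exists i => //; rewrite -Ei.
Qed.

Lemma decision_class_neq0 MM M :
  decision_class MM -> M \in MM -> M != finset.set0.
Proof. by move=> dMM MMM; apply: contraNneq dMM => <-. Qed.

(** In both cases of the gap the competitors are the super arms that disagree with [Mstar] about
    [e]; this form spares later case distinctions. *)
Lemma gapBE MM w Mstar e :
  gapB MM w Mstar e = (MinW Mstar (mean_vector w) -
    \big[Order.max/-oo]_(M in MM | (e \in M) == (e \notin Mstar))
      MinW M (mean_vector w))%E.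
Proof.
rewrite /gapB; case: ifP => eM; congr (_ - _)%E; apply: eq_bigl => M.
  by rewrite eqbF_neg.
by rewrite eqb_id.
Qed.

Lemma gapB_le MM w Mstar e M :
  M \in MM -> (e \in M) = (e \notin Mstar) ->
  (gapB MM w Mstar e <=
    MinW Mstar (mean_vector w) - MinW M (mean_vector w))%E.
Proof.
move=> MMM eM; rewrite gapBE leeB//.
apply: (le_bigmax_cond _ (fun M => MinW M (mean_vector w))).
by rewrite MMM eM eqxx.
Qed.

Lemma gapB_gt0 MM w Mstar e : decision_class MM -> unique_optimum MM w Mstar ->
  (0 < gapB MM w Mstar e)%E.
Proof.
move=> dMM [MsMM uniqMs]; rewrite gapBE sube_gt0.
have [i _ opt] := MinW_attained (mean_vector w) (decision_class_neq0 dMM MsMM).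
apply: bigmax_lt => [|M /andP[MMM /eqP eM]]; first by rewrite opt ltNyr.
by apply: uniqMs => //; apply: contra_eq_neq eM => ->; case: (e \in Mstar).
Qed.

(** A super arm that disagrees with [M] about [e] and avoids [Rj] is feasible for the runner-up
    query at [e]. *)
Lemma oracle_flip_le MM (oracle : oracle_type R n) v Rj M N (e : 'I_n) :
  AR_oracle MM oracle -> N \in MM -> [disjoint N & Rj]%B ->
  (e \in N) = (e \notin M) ->
  (MinW N v <= MinW_opt
    (if e \in M then oracle None (e |: Rj) v else oracle (Some e) Rj v) v)%E.
Proof.
move=> orac NMM NRj; case: ifPn => eM eN.
  have := orac None (e |: Rj) v.
  have fN : AR_feasible MM None (e |: Rj) N.
    by rewrite /AR_feasible NMM/= disjoint_setU1r NRj eN.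
  by case: (oracle _ _ _) => [M' [_ /(_ _ fN)]|/(_ N)]; rewrite ?fN.
have := orac (Some e) Rj v.
have fN : AR_feasible MM (Some e) Rj N by rewrite /AR_feasible NMM eN.
by case: (oracle _ _ _) => [M' [_ /(_ _ fN)]|/(_ N)]; rewrite ?fN.
Qed.

(** Conversely, an answer of that query disagrees with [M] about [e]; when there is no answer the
    value is [-oo], which is why [b] must exceed it. *)
Lemma oracle_flip_lt MM (oracle : oracle_type R n) v Rj M e b :
  AR_oracle MM oracle -> (-oo < b)%E ->
  (forall N, N \in MM -> [disjoint N & Rj]%B -> (e \in N) = (e \notin M) ->
    MinW N v < b)%E ->
  (MinW_opt (if e \in M then oracle None (e |: Rj) v else oracle (Some e) Rj v) v
    < b)%E.
Proof.
move=> orac b_gt H; case: ifPn => eM.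
  have := orac None (e |: Rj) v.
  case: (oracle _ _ _) => [N|//] /= [/and3P[NMM _]].
  rewrite disjoint_setU1r => /andP[eN NRj] _.
  by apply: H => //; rewrite eM; exact/negbTE.
have := orac (Some e) Rj v.
case: (oracle _ _ _) => [N|//] /= [/and3P[NMM eN NRj] _].
by apply: H => //; rewrite eN eM.
Qed.

End bottleneck.

(** * Correctness of one round *)

Section round.
Variables (R : realType) (n : nat).
Variables (MM : {set {set 'I_n}}) (w : 'I_n -> R) (Mstar : {set 'I_n}).
Hypotheses (dMM : decision_class MM) (optMs : unique_optimum MM w Mstar).

Variables (A Rj : {set 'I_n}) (m : 'I_n -> R) (D : \bar R).
Hypotheses (AMs : A \subset Mstar) (MsRj : [disjoint Mstar & Rj]%B).
Hypothesis D0 : (0 < D)%E.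
Hypothesis m_close : D \is a fin_num ->
  forall e, e \notin (A :|: Rj)%SET -> `|m e - w e| < fine D / 2.

Let v e : \bar R := if e \in A then +oo%E else (m e)%:E.

Lemma MinW_gtNy (M : {set 'I_n}) : M != finset.set0 -> (-oo < MinW M v)%E.
Proof.
move=> /(MinW_attained v)[e _ ->]; rewrite /v.
by case: ifP => _; rewrite ?ltNyr.
Qed.

(** The level OPT - D/2 separates the two values: the true bottleneck of [M] has mean at most OPT -
    D, while each arm of [Mstar] is either accepted, with value [+oo], or has mean at least OPT;
    estimates err by less than D/2. *)
Lemma MinW_separated e M : (D <= gapB MM w Mstar e)%E ->
  M \in MM -> [disjoint M & Rj]%B -> (e \in M) = (e \notin Mstar) ->
  (MinW M v < MinW Mstar v)%E.
Proof.
move=> De MMM MRj eM.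
have Ms0 := decision_class_neq0 dMM optMs.1.
have [e1 e1M E1] := MinW_attained (mean_vector w) (decision_class_neq0 dMM MMM).
have [e2 e2M E2] := MinW_attained (mean_vector w) Ms0.
have := le_trans De (gapB_le w MMM eM); rewrite E1 E2 -EFinB => Dle.
(* A competitor exists, so [D] is at most a difference of reals; an infinite [D] needs no closeness
   of the estimates. *)
have Dfin : D \is a fin_num.
  by rewrite fin_real// (lt_trans _ D0)//= (le_lt_trans Dle)// ltry.
move: D0 Dle (m_close Dfin); rewrite -(fineK Dfin) lte_fin lee_fin fineK//.
move: (fine D) => D' D'0 D'le close.
(* An accepted arm lies in [Mstar] and so has mean at least OPT, whereas [e1] falls short of OPT by
   at least D. *)
have e1A : e1 \notin A.
  apply/negP => /(fintype.subsetP AMs) /(MinW_le (mean_vector w)).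
  by rewrite E2 lee_fin; lra.
have /close e1c : e1 \notin (A :|: Rj)%SET.
  by rewrite inE negb_or e1A (disjointFr MRj e1M).
apply: (le_lt_trans (MinW_le v e1M)); rewrite {1}/v (negbTE e1A).
have [e3 e3M ->] := MinW_attained v Ms0; rewrite /v.
case: ifPn => e3A; first by rewrite ltry.
have /close e3c : e3 \notin (A :|: Rj)%SET.
  by rewrite inE negb_or e3A (disjointFr MsRj e3M).
have := MinW_le (mean_vector w) e3M; rewrite E2 !lee_fin lte_fin => w23.
by move: e1c e3c; rewrite !ltr_norml => /andP[_ ?] /andP[? _]; lra.
Qed.

Variable oracle : oracle_type R n.
Hypothesis orac : AR_oracle MM oracle.

Lemma round_correct (e p : 'I_n) :
  (D <= gapB MM w Mstar e)%E ->
  let Mt := oracle None Rj v in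
  let in_Mt := fun e' => if Mt is Some M then e' \in M else false in
  let gap := fun e' => (MinW_opt Mt v - MinW_opt
    (if in_Mt e' then oracle None (e' |: Rj)%SET v
     else oracle (Some e') Rj v) v)%E in
  (gap e <= gap p)%E -> in_Mt p = (p \in Mstar).
Proof.
move=> De Mt in_Mt gap; have [MsMM uniqMs] := optMs.
have fMs : AR_feasible MM None Rj Mstar by rewrite /AR_feasible MsMM.
have := orac None Rj v; rewrite /gap /in_Mt -/Mt.
case: {gap in_Mt}Mt => [M [/and3P[MMM _ MRj] /(_ _ fMs) le_M]|/(_ Mstar)];
  last by rewrite fMs.
have eM : (e \in M) = (e \in Mstar).
  apply: contraTeq le_M => eM; rewrite -ltNge.
  by apply: (MinW_separated De) => //; move: eM; do 2 case: (e \in _).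
move=> gap_le; apply/eqP; apply: contraT => pM.
have Mbig : (-oo < MinW Mstar v)%E.
  exact/MinW_gtNy/(decision_class_neq0 dMM MsMM).
(* Since [M] and [Mstar] agree about [e], disagreeing with [M] there means disagreeing with [Mstar],
   and separation applies. *)
have flip_e := oracle_flip_lt orac Mbig (fun N NMM NRj eN =>
  MinW_separated De NMM NRj (etrans eN (congr1 negb eM))).
have flip_p : (MinW Mstar v <= MinW_opt
    (if p \in M then oracle None (p |: Rj)%SET v
     else oracle (Some p) Rj v) v)%E.
  by apply: oracle_flip_le orac _ _ _ => //; move: pM; do 2 case: (p \in _).
have MneqMs : M != Mstar by apply: contraNneq pM => ->.
(* Cancelling [MinW M v] from the two empirical gaps requires it to be finite. By uniqueness of the
   optimum [M] is not contained in [Mstar], so it has an arm that is not accepted. *)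
have Mfin : MinW M v \is a fin_num.
  rewrite fin_numElt MinW_gtNy ?(decision_class_neq0 dMM MMM)//=.
  have /fintype.subsetPn[e1 e1M e1Ms] : ~~ (M \subset Mstar).
    apply/negP => MMs.
    have := uniqMs _ MMM MneqMs; rewrite ltNge => /negP; apply.
    have M0 := decision_class_neq0 dMM MMM.
    have [e2 e2M ->] := MinW_attained (mean_vector w) M0.
    exact/MinW_le/(fintype.subsetP MMs).
  apply: le_lt_trans (MinW_le v e1M) _; rewrite /v ifN ?ltry//.
  by apply: contra e1Ms; exact: (fintype.subsetP AMs).
have := lt_le_trans flip_e flip_p; rewrite ltNge => /negP[].
by move: gap_le; rewrite leeD2lE// leeN2.
Qed.
End round.

(** * Order statistics of the gaps *)

Lemma sorted_gapsB_le (R : realType) n (MM : {set {set 'I_n}}) (w : 'I_n -> R)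
    (Mstar U : {set 'I_n}) i : (i < #|U|)%N ->
  exists2 e, e \in U &
    (nth 0 (sorted_gapsB MM w Mstar) i <= gapB MM w Mstar e)%E.
Proof.
move=> iU; pose D : \bar R := nth 0%E (sorted_gapsB MM w Mstar) i.
have [/existsP[e /andP[eU De]]|noe] :=
  boolP [exists e, (e \in U) && (D <= gapB MM w Mstar e)%E]; first by exists e.
suff : (D < D)%E by rewrite ltxx.
(* If all arms of [U] had gaps below [D], more than [i] entries of the sorted list would be below
   its entry of index [i]. *)
apply: nth_count_lt; first exact: sort_le_sorted.
rewrite /sorted_gapsB (permP (permEl (perm_sort _ _))) count_map.
rewrite -size_filter (leq_trans iU)// cardE.
apply: uniq_leq_size => [|e]; first exact: enum_uniq.
rewrite mem_enum mem_filter mem_enum andbT => eU /=.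
by rewrite ltNge; apply: contra noe => De; apply/existsP; exists e; rewrite eU.
Qed.

Lemma sorted_gapsB_gt0 (R : realType) n (MM : {set {set 'I_n}}) (w : 'I_n -> R)
    (Mstar : {set 'I_n}) i :
  decision_class MM -> unique_optimum MM w Mstar -> (i < n)%N ->
  (0 < nth 0 (sorted_gapsB MM w Mstar) i)%E.
Proof.
move=> dMM optMs i_n; have : nth 0%E (sorted_gapsB MM w Mstar) i \in
    sorted_gapsB MM w Mstar.
  by apply: mem_nth; rewrite size_sort size_map size_enum_ord.
by rewrite mem_sort => /mapP[e _ ->]; exact: gapB_gt0.
Qed.

(** * Phase lengths and the sample budget *)

Section Ttilde_theory.
Variables (R : realType) (n T : nat).
Hypothesis nT : (n < T)%N.

Lemma logtilde_gt0 : (0 < n)%N -> 0 < logtilde R n.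
Proof.
case: n => // k _; rewrite /logtilde big_nat_recl//=.
rewrite ltr_wpDr ?invr_gt0 ?ltr0n//.
by apply: sumr_ge0 => i _; rewrite invr_ge0 ler0n.
Qed.

Let q t : R := (T%:R - n%:R) / (logtilde R n * (n - t + 1)%:R).

Let q_gt0 t : (0 < t <= n)%N -> 0 < q t.
Proof.
move=> /andP[t0 tn]; rewrite divr_gt0 ?subr_gt0 ?ltr_nat//.
by rewrite mulr_gt0 ?logtilde_gt0 ?(leq_trans t0)// ltr0n addn1.
Qed.

Let TtildeE t : (0 < t <= n)%N ->
  (Ttilde R n T t)%:R = (Num.ceil (q t))%:~R :> R.
Proof.
move=> tn; case: t tn => // t tn.
rewrite /Ttilde -/(q t.+1) natr_absz ger0_norm// ceil_ge0.
by rewrite (lt_trans _ (q_gt0 tn)).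
Qed.

Lemma Ttilde_ge t : (0 < t <= n)%N ->
  (T%:R - n%:R) / (logtilde R n * (n - t + 1)%:R) <= (Ttilde R n T t)%:R :> R.
Proof. by move=> tn; rewrite TtildeE// ceil_ge. Qed.

Lemma Ttilde_gt0 t : (0 < t <= n)%N -> (0 < Ttilde R n T t)%N.
Proof.
by move=> tn; rewrite -(ltr0n R) (lt_le_trans (q_gt0 tn))// Ttilde_ge.
Qed.

Lemma Ttilde_lt t : (0 < t <= n)%N ->
  (Ttilde R n T t)%:R < (T%:R - n%:R) / (logtilde R n * (n - t + 1)%:R) + 1 :> R.
Proof.
move=> tn.
by rewrite TtildeE// -ltrBlDr -[X in _ - X]/1%:~R -intrB ceilB1_lt.
Qed.

(** Guarantees that the truncated subtraction giving the plays of a round is a true difference. *)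
Lemma Ttilde_leS t : (t < n)%N -> (Ttilde R n T t <= Ttilde R n T t.+1)%N.
Proof.
case: t => [//|t] tn; rewrite -(ler_nat R) !TtildeE//; last exact: ltnW.
rewrite ler_int le_ceil// ler_wpM2l ?subr_ge0 ?ler_nat ?(ltnW nT)//.
have L0 : 0 < logtilde R n by apply: logtilde_gt0; lia.
rewrite lef_pV2 ?posrE ?mulr_gt0 ?ltr0n ?addn1//.
by rewrite ler_pM2l// ler_nat; lia.
Qed.

(** Rounding up costs at most 1 per phase, hence [n] in all; the reciprocals of [n - t + 1] add up
    to [logtilde R n], so the rest is at most T - n. *)
Lemma sum_Ttilde : (\sum_(1 <= t < n.+1) Ttilde R n T t <= T)%N.
Proof.
rewrite -(ler_nat R) natr_sum.
have [->|n0] := posnP n; first by rewrite big_nil.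
have L0 : 0 < logtilde R n by exact: logtilde_gt0.
apply: (@le_trans _ _ (\sum_(1 <= t < n.+1)
    ((T%:R - n%:R) / logtilde R n * (n - t + 1)%:R^-1 + 1))).
  rewrite !big_nat; apply: ler_sum => t tn.
  by rewrite (le_trans (ltW (Ttilde_lt _)))// invfM mulrA.
rewrite big_split/= -mulr_sumr sumr_const_nat subn1/=.
rewrite (_ : \sum_(1 <= t < n.+1) _ = logtilde R n); last first.
  rewrite /logtilde [RHS]big_nat_rev/= !big_nat; apply: eq_bigr => t tn.
  by congr (_%:R^-1); lia.
by rewrite divfK ?gt_eqF// subrK.
Qed.

End Ttilde_theory.

(** * The whole run: sample counts and the invariant *)

Section bsar_run.
Variables (R : realType) (n T : nat) (oracle : oracle_type R n).
Variables (sel : select_type R n) (x : 'I_n -> nat -> R).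
Hypotheses (nT : (n < T)%N) (selP : argmax_select sel).

Let st t := bsar_after T oracle sel x t.
Let decided t := (accepted (st t) :|: rejected (st t))%SET.

Lemma bsar_step_decides t (s : bsar_state n) :
  let U := (~: (accepted s :|: rejected s))%SET in
  let s' := bsar_step T oracle sel x t s in
  (0 < #|U|)%N -> exists2 p, p \in U &
    (accepted s' :|: rejected s')%SET = (p |: (accepted s :|: rejected s))%SET.
Proof.
move=> U s' U0; rewrite /s' /bsar_step -/U.
set p := sel _ _ _; exists p; first exact: (selP _ _ U0).1.
by case: ifP => _ /=; rewrite finset.setUA // finset.setUCA finset.setUA.
Qed.

Lemma card_decided t : (t <= n)%N -> #|decided t| = t.
Proof.
elim: t => [|t IH] tn; first by rewrite /decided /= finset.setU0 cards0.
have cU : #|~: decided t|%SET = (n - t)%N.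
  by rewrite cardsCs finset.setCK IH ?card_ord// ltnW.
have [|p pU] := @bsar_step_decides t.+1 (st t); first by rewrite cU subn_gt0.
rewrite /decided /= => ->; rewrite cardsU1 IH ?(ltnW tn)//.
by rewrite finset.in_setC in pU; rewrite pU.
Qed.

Lemma card_undecided t : (t <= n)%N -> #|(~: decided t)%SET| = (n - t)%N.
Proof. by move=> tn; rewrite cardsCs finset.setCK card_decided ?card_ord. Qed.

Lemma decided_leS t : (t < n)%N -> decided t \subset decided t.+1.
Proof.
move=> tn; have [|p pU] := @bsar_step_decides t.+1 (st t).
  by rewrite card_undecided ?subn_gt0// ltnW.
by rewrite /decided /= => ->; exact: finset.subsetUr.
Qed.

Lemma playsS t e : plays (st t.+1) e = if e \notin decided t
  then (plays (st t) e + (Ttilde R n T t.+1 - Ttilde R n T t))%N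
  else plays (st t) e.
Proof.
by rewrite /= /bsar_step (fun_if (@plays n)) /= if_same finset.in_setC.
Qed.

Lemma plays_undecided t e : (t <= n)%N -> e \notin decided t ->
  plays (st t) e = Ttilde R n T t.
Proof.
elim: t => [//|t IH] tn eU.
have eU' : e \notin decided t.
  by apply: contra eU; exact/fintype.subsetP/decided_leS.
by rewrite playsS eU' IH ?(ltnW tn)// subnKC// Ttilde_leS.
Qed.

(** The arm decided in round [s] stops at [Ttilde R n T s] samples, and each of the [n - t]
    undecided arms has [Ttilde R n T t]. The second term vanishes at [t = n]. *)
Lemma sum_plays t : (t <= n)%N -> (\sum_e plays (st t) e =
  \sum_(1 <= s < t.+1) Ttilde R n T s + (n - t) * Ttilde R n T t)%N.
Proof.
elim: t => [|t IH] tn; first by rewrite big1// big_nil muln0.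
under eq_bigr do rewrite playsS.
rewrite (eq_bigr (fun e => plays (st t) e + (if e \in (~: decided t)%SET
    then Ttilde R n T t.+1 - Ttilde R n T t else 0))%N); last first.
  by move=> e _; rewrite finset.in_setC; case: ifP => // _; rewrite addn0.
rewrite big_split/= -big_mkcond/= sum_nat_const card_undecided ?(ltnW tn)//.
rewrite IH ?(ltnW tn)// [in RHS]big_nat_recr//= -!addnA; congr addn.
rewrite -mulnDr subnKC ?Ttilde_leS//.
by rewrite -mulSn subnSK.
Qed.

Lemma bsar_samples_le : (bsar_samples T oracle sel x <= T)%N.
Proof.
rewrite /bsar_samples sum_plays// subnn mul0n addn0.
exact: sum_Ttilde R _ _ nT.
Qed.

Variables (MM : {set {set 'I_n}}) (w : 'I_n -> R) (Mstar : {set 'I_n}).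
Hypotheses (dMM : decision_class MM) (optMs : unique_optimum MM w Mstar).
Hypothesis orac : AR_oracle MM oracle.
(** Round [t.+1] starts with [n - t] undecided arms; the 0-based index [n - t.+1] picks the gap of
    rank [n - t]. *)
Let D t : \bar R := nth 0%E (sorted_gapsB MM w Mstar) (n - t.+1).
Hypothesis close : forall t e, (t < n)%N -> D t \is a fin_num ->
  `|emp_mean (x e) (Ttilde R n T t.+1) - w e| < fine (D t) / 2.

Lemma bsar_invariant t : (t <= n)%N ->
  accepted (st t) \subset Mstar /\ [disjoint Mstar & rejected (st t)]%B.
Proof.
elim: t => [_|t IH tn].
  rewrite /= finset.sub0set; split => //.
  by rewrite -finset.setI_eq0 finset.setI0.
have [AMs MsR] := IH (ltnW tn).
have [e eU De] : exists2 e, e \in (~: decided t)%SET &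
    (D t <= gapB MM w Mstar e)%E.
  by apply: sorted_gapsB_le; rewrite card_undecided ?(ltnW tn)//; lia.
have D0 : (0 < D t)%E by apply: sorted_gapsB_gt0 => //; lia.
have U0 : (0 < #|(~: decided t)%SET|)%N.
  by rewrite card_undecided ?subn_gt0 ?(ltnW tn).
have -> : st t.+1 = bsar_step T oracle sel x t.+1 (st t) by [].
rewrite /bsar_step -/(decided t).
set N := fun e' => if e' \in _ then _ else _.
pose m e' := emp_mean (x e') (N e').
have m_close : D t \is a fin_num -> forall e', e' \notin decided t ->
    `|m e' - w e'| < fine (D t) / 2.
  (* The estimate includes the plays of the current round, so an undecided arm has exactly
     [Ttilde R n T t.+1] samples. *)
  move=> Dfin e' e'U; rewrite /m /N finset.in_setC e'U.
  rewrite plays_undecided ?(ltnW tn)//.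
  by rewrite subnKC ?Ttilde_leS//; exact: close.
set p := sel _ _ _.
have [pU gap_max] : p \in (~: decided t)%SET /\ _ := selP t.+1 _ U0.
have := round_correct dMM optMs AMs MsR D0 m_close orac De (gap_max e eU).
rewrite -/p => inMt; rewrite inMt; case: ifP => pMs /=.
  split=> //; apply/fintype.subsetP => e'; rewrite inE => /orP[|]; last first.
    exact: (fintype.subsetP AMs).
  by rewrite inE => /eqP ->.
by split => //; rewrite disjoint_setU1r pMs.
Qed.

Lemma bsar_output_correct : bsar_output T oracle sel x = Mstar.
Proof.
have [AMs MsR] := bsar_invariant (leqnn n).
apply/eqP; rewrite finset.eqEsubset AMs; apply/fintype.subsetP => e eMs.
have : decided n = finset.setT.
  by apply/eqP; rewrite eqEcard finset.subsetT cardsT card_ord card_decided/=.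
move/setP => /(_ e); rewrite !inE => /orP[//|].
by rewrite (disjointFr MsR eMs).
Qed.

End bsar_run.

(** * Probability of a bad run *)

(** Taken with [h := pair e], this extracts the samples of one arm; the left inverse [g] carries
    events indexed by [J] over to [I]. *)
Lemma mutually_independent_comp d (Omega : measurableType d) (R : realType)
    (P : probability Omega R) (I J : eqType) (X : I -> Omega -> R)
    (h : J -> I) (g : I -> J) :
  cancel h g -> mutually_independent P X -> mutually_independent P (X \o h).
Proof.
move=> hK indX s B us mB.
have := indX (map h s) (B \o g); rewrite (map_inj_uniq (can_inj hK)) => /(_ us).
rewrite big_map /=; under eq_bigr do rewrite hK.
move=> <- //; congr (P _); apply/seteqP; split => x /=.
  by move=> H _ /mapP[j js ->] /=; rewrite hK; exact: H.
by move=> H j js; have := H (h j) (map_f h js); rewrite /= hK.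
Qed.

Lemma measure_bigsetU_le d (T : measurableType d) (R : realType)
    (mu : {measure set T -> \bar R}) (I : Type) (s : seq I) (A : I -> set T) :
  (forall i, measurable (A i)) ->
  (mu (\big[setU/set0]_(i <- s) A i) <= \sum_(i <- s) mu (A i))%E.
Proof.
move=> mA; elim: s => [|i s IH]; first by rewrite !big_nil measure0.
rewrite !big_cons; apply: le_trans (leeD2l _ IH).
by apply: measureU2 => //; exact: bigsetU_measurable.
Qed.

Lemma exponentB_le (R : realType) (n T k i : nat) (r D : R) (H : \bar R) :
  (n < T)%N -> (0 < i <= n)%N -> 0 < r -> 0 < D ->
  (((i%:R / D ^+ 2)%:E) <= H)%E ->
  (T%:R - n%:R) / (logtilde R n * i%:R) <= k%:R ->
  (exponentB n T r H <= (k%:R * D ^+ 2 / r ^+ 2)%:E)%E.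
Proof.
move=> nT /andP[i0 i_n] r0 D0 HD kT.
have n0 : (0 < n)%N by exact: leq_trans i_n.
have L0 : 0 < logtilde R n by exact: logtilde_gt0.
have T0 : 0 < T%:R - n%:R :> R by rewrite subr_gt0 ltr_nat.
have iR : 0 < i%:R :> R by rewrite ltr0n.
have g0 : 0 < i%:R / D ^+ 2 by rewrite divr_gt0// exprn_gt0.
have r20 : 0 < r ^+ 2 by rewrite exprn_gt0.
(* Replacing [H] by its positive lower bound enlarges the quotient, inversion being antitone on
   nonnegative extended reals; the rest is real arithmetic. *)
apply: (@le_trans _ _ ((T%:R - n%:R)%:E /
    ((logtilde R n * r ^+ 2)%:E * (i%:R / D ^+ 2)%:E))%E).
  apply: lee_wpmul2l; first by rewrite lee_fin ltW.
  rewrite lee_pV2 ?inE.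
  - by apply: lee_wpmul2l => //; rewrite lee_fin mulr_ge0// ltW.
  - rewrite mule_ge0//; first by rewrite lee_fin mulr_ge0// ltW.
    by apply: le_trans HD; rewrite lee_fin ltW.
  - by rewrite -EFinM lee_fin ltW// mulr_gt0// mulr_gt0.
rewrite -EFinM inver gt_eqF; last by rewrite mulr_gt0// mulr_gt0.
rewrite lee_fin.
apply: (@le_trans _ _
    ((T%:R - n%:R) / (logtilde R n * i%:R) * (D ^+ 2 / r ^+ 2))).
  rewrite le_eqVlt; apply/orP; left; apply/eqP.
  by field; rewrite !gt_eqF.
by rewrite -[leRHS]mulrA ler_wpM2r// divr_ge0// sqr_ge0.
Qed.

(** * Union bound over rounds and arms *)

Section error_bound.
Variables (R : realType) (n : nat) (MM : {set {set 'I_n}}).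
Variables (w : 'I_n -> R) (Mstar : {set 'I_n}).

Lemma HB_ge i (D : R) : (0 < i <= n)%N -> D != 0 ->
  nth 0%E (sorted_gapsB MM w Mstar) i.-1 = D%:E ->
  ((i%:R / D ^+ 2)%:E <= HB MM w Mstar)%E.
Proof.
move=> /andP[i0 i_n] D0 nthD.
have -> : ((i%:R / D ^+ 2)%:E =
    i%:R%:E / (nth 0 (sorted_gapsB MM w Mstar) i.-1) ^+ 2)%E.
  by rewrite nthD -EFin_expe inver sqrf_eq0 (negbTE D0) EFinM.
rewrite /HB.
apply: (@le_bigmax_seq _ _ _ _ _ i xpredT
  (fun i => i%:R%:E / (nth 0 (sorted_gapsB MM w Mstar) i.-1) ^+ 2)%E) => //.
by rewrite mem_index_iota i0 ltnS.
Qed.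

Variables (nu : 'I_n -> probability R R) (r : R) (T : nat).
Context d (Omega : measurableType d) (P : probability Omega R).
Variable X : 'I_n -> nat -> {RV P >-> R}.
Hypotheses (r0 : 0 < r) (nT : (n < T)%N).
Hypothesis sgX : forall e, sub_gaussian (nu e) (w e) r.
Hypothesis samX : reward_samples nu X.

Lemma reward_tail e (k : nat) (eps : R) : 0 < eps -> (0 < k)%N ->
  (P [set om | (eps <= `|emp_mean (X e ^~ om) k - w e|)%R] <=
    (2 * expR (- (k%:R * eps ^+ 2 / (2 * r ^+ 2))))%:E)%E.
Proof.
move=> eps0 k0; apply: (@emp_mean_tail _ _ _ P (X e)) => //.
- by exact: (mutually_independent_comp (h := pair e) (g := snd) _ samX.2).
- move=> s lam; apply: le_trans (sgX e lam).
  pose f y : \bar R := (expR (lam * (y - w e)))%:E.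
  have mf : measurable_fun [set: R] f.
    apply/measurable_EFinP; apply: measurableT_comp => //.
    by apply: measurable_funM => //; apply: measurable_funB.
  (* Change of variables: the integral is taken against the law of [X e s], which is [nu e]. *)
  rewrite -(ge0_integral_distribution (X e s) mf); last first.
    by move=> y; rewrite lee_fin expR_ge0.
  rewrite le_eqVlt; apply/orP; left; apply/eqP.
  by apply: eq_measure_integral => B mB _; exact: samX.1.
Qed.


Let D t : \bar R := nth 0%E (sorted_gapsB MM w Mstar) (n - t.+1).
(** The event concerns a deterministic number of entries of the reward table, whether or not the run
    ever reads them, so the tail bound applies without conditioning on the run. *)
Let bad (p : 'I_n * 'I_n) : set Omega := [set om | D p.1 \is a fin_num /\
  fine (D p.1) / 2 <=
    `|emp_mean (X p.2 ^~ om) (Ttilde R n T p.1.+1) - w p.2|].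
Let bound : \bar R := (2%:E *
  expeR (- ((8^-1)%:E * exponentB n T r (HB MM w Mstar))))%E.

Hypotheses (dMM : decision_class MM) (optMs : unique_optimum MM w Mstar).

Lemma measurable_bad p : measurable (bad p).
Proof.
have [Dfin|Dfin] := boolP (D p.1 \is a fin_num); last first.
  rewrite (_ : bad p = classical_sets.set0) //.
  by apply/seteqP; split => x //= -[]; rewrite (negbTE Dfin).
pose g om := `|emp_mean (X p.2 ^~ om) (Ttilde R n T p.1.+1) - w p.2|.
have mg : measurable_fun [set: Omega] g.
  apply: measurableT_comp => //; apply: measurable_funB => //.
  apply: measurable_funM => //; apply: measurable_sum => i.
  exact: measurable_funPT.
rewrite (_ : bad p = g @^-1` `[fine (D p.1) / 2, +oo[%classic); last first.
  by apply/seteqP; split => x /=; rewrite in_itv/= andbT => // -[].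
by rewrite -[_ @^-1` _]setTI; exact: mg.
Qed.

(** The rank n - t of the gap is also the denominator in the phase length, so the sample count times
    the squared gap is at least (T - n) / (log~(n) H). *)
Lemma prob_bad p : (P (bad p) <= bound)%E.
Proof.
have pn := ltn_ord p.1.
have [Dfin|Dfin] := boolP (D p.1 \is a fin_num); last first.
  rewrite (_ : bad p = classical_sets.set0); last first.
    by apply/seteqP; split => x //= -[]; rewrite (negbTE Dfin).
  by rewrite measure0 mule_ge0// expeR_ge0.
pose k := Ttilde R n T p.1.+1; pose D' := fine (D p.1).
have D'E : D p.1 = D'%:E by rewrite fineK.
have D'0 : 0 < D'.
  by rewrite -lte_fin -D'E; apply: sorted_gapsB_gt0 => //; lia.
have k0 : (0 < k)%N by apply: (Ttilde_gt0 R nT).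
have in_n : (0 < n - p.1 <= n)%N by lia.
rewrite (_ : bad p = [set om | D' / 2 <= `|emp_mean (X p.2 ^~ om) k - w p.2|]);
  last by apply/seteqP; split => x //= [].
apply: le_trans (reward_tail _ _ k0) _; first by rewrite divr_gt0.
rewrite EFinM lee_wpmul2l//.
(* The factor 1/8 combines the squared half-width (D/2)^2 with the 1/2 of the sub-Gaussian
   exponent. *)
rewrite (_ : (expR _)%:E =
    expeR (- ((8^-1)%:E * (k%:R * D' ^+ 2 / r ^+ 2)%:E))%E); last first.
  by rewrite -EFinM -EFinN /=; congr (expR _)%:E; field; rewrite gt_eqF.
rewrite lee_expeR leeN2 lee_wpmul2l// ?lee_fin//.
apply: (exponentB_le nT in_n r0 D'0).
  apply: HB_ge => //; first by rewrite gt_eqF.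
  by rewrite -D'E /D; congr nth; lia.
have := @Ttilde_ge R n T nT p.1.+1.
rewrite (_ : n - p.1.+1 + 1 = n - p.1)%N; last lia.
by apply.
Qed.

(** Correctness of a good run holds outcome by outcome, so tie-breaking may depend on [om]; [mout]
    makes the error event measurable. *)
Lemma bsar_error (oracle : Omega -> oracle_type R n)
    (sel : Omega -> select_type R n) :
  let out om := bsar_output T (oracle om) (sel om) (fun e s => X e s om) in
  (forall om, AR_oracle MM (oracle om)) ->
  (forall om, argmax_select (sel om)) ->
  (forall M : {set 'I_n}, measurable [set om | out om = M]) ->
  (P [set om | out om <> Mstar] <= (2 * n%:R ^+ 2)%:E *
    expeR (- ((8^-1)%:E * exponentB n T r (HB MM w Mstar))))%E.
Proof.
move=> out orac selP mout.
pose s := index_enum ('I_n * 'I_n)%type.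
apply: (@le_trans _ _ (P (\big[setU/classical_sets.set0]_(p <- s) bad p))).
  apply: le_measure; rewrite ?inE.
  - rewrite (_ : [set om | _] = ~` [set om | out om = Mstar]) //.
    exact: measurableC.
  - by apply: bigsetU_measurable => p _; exact: measurable_bad.
  move=> om /=; apply: contra_notP => nbad.
  apply: (bsar_output_correct nT (selP om) dMM optMs (orac om)) => t e tn Dfin.
  rewrite ltNge; apply/negP => le_D; apply: nbad.
  rewrite -bigcup_seq; exists (Ordinal tn, e) => //=.
  exact: mem_index_enum.
apply: le_trans (measure_bigsetU_le _ _ measurable_bad) _.
apply: (@le_trans _ _ (\sum_(p <- s) 1%:E * bound)%E).
  by apply: lee_sum => p _; rewrite mul1e; exact: prob_bad.
rewrite -ge0_sume_distrl// sumEFin /s sumr_const card_prod !card_ord /bound.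
by rewrite muleA -EFinM natrM -expr2 mulrC.
Qed.

End error_bound.

Theorem theorem4 (R : realType) :
  exists C c : R, 0 < C /\ 0 < c /\
  forall (n : nat) (MM : {set {set 'I_n}})
    (nu : 'I_n -> probability R R) (w : 'I_n -> R) (r : R)
    (Mstar : {set 'I_n}) (T : nat)
    (d : measure_display) (Omega : measurableType d) (P : probability Omega R)
    (X : 'I_n -> nat -> {RV P >-> R})
    (oracle : Omega -> oracle_type R n) (sel : Omega -> select_type R n),
  let BSAR_output (om : Omega) :=
    bsar_output T (oracle om) (sel om) (fun e s => X e s om) in
  let BSAR_samples (om : Omega) :=
    bsar_samples T (oracle om) (sel om) (fun e s => X e s om) in
  decision_class MM ->
  0 < r ->
  (forall e, has_mean (nu e) (w e)) ->
  (forall e, sub_gaussian (nu e) (w e) r) ->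
  unique_optimum MM w Mstar ->
  reward_samples nu X ->
  (forall om, AR_oracle MM (oracle om)) ->
  (forall om, argmax_select (sel om)) ->
  (forall M : {set 'I_n}, measurable [set om | BSAR_output om = M]) ->
  (n < T)%N ->
  (forall om, (BSAR_samples om <= T)%N) /\
  (P [set om | BSAR_output om <> Mstar]
     <= (C * n%:R ^+ 2)%:E * expeR (- (c%:E * exponentB n T r (HB MM w Mstar))))%E.
Proof.
(* The 2 counts the two tails of the deviation bound; 1/8 is the constant of [prob_bad]. *)
exists 2, 8^-1; split=> //; split=> //.
move=> n MM nu w r Mstar T d Omega P X oracle sel BSAR_output BSAR_samples.
move=> dMM r0 _ sgX optMs samX orac selP mout nT; split.
  by move=> om; apply: bsar_samples_le.
exact: (bsar_error r0 nT sgX samX dMM optMs orac selP mout).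
Qed.
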